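(* There exists a randomized one-pass streaming algorithm that, given $\epsilon,\rho \in (0,1)$ and a stream of axis-parallel hyperrectangles in $[0,1]^d$, outputs an $(\epsilon,\rho)$-additive solution to Klee's measure and uses $O\left(\frac{1}{\epsilon^2}\log\left(\frac{1}{\rho}\right)\right)$ space.
   Context: Klee's measure of a stream of axis-parallel hyperrectangles $R_1,\ldots,R_n \subset [0,1]^d$ is the volume $V$ of $\bigcup_{i=1}^n R_i$. A one-pass (insertion-only) streaming algorithm reads the items once in order and keeps only a sketch in memory. Space is counted in words, where a word can hold a point of $\mathbb{R}^d$, any input parameter, and a $\lceil \log n\rceil$-bit counter ($n$ is the stream length). An $(\epsilon,\rho)$-additive solution is an output $\hat V$ with $|V-\hat V| \le \epsilon$ with probability at least $1-\rho$. *)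

(* Defs.v *)
From HB Require Import structures.
From mathcomp Require Import all_boot all_order all_algebra.
From mathcomp Require Import all_classical all_reals all_analysis.

Set Implicit Arguments.
Unset Strict Implicit.
Unset Printing Implicit Defensive.

Import Order.TTheory GRing.Theory Num.Theory.
Import numFieldNormedType.Exports.

Local Open Scope classical_set_scope.
Local Open Scope ring_scope.

Section power_measure.
Local Open Scope ereal_scope.
Context {R : realType} {disp : measure_display} {T : measurableType disp}.

Definition tcons n (p : T * n.-tuple T) : n.+1.-tuple T := [tuple of p.1 :: p.2].

Lemma measurable_tcons n : measurable_fun setT (@tcons n).
Proof. exact: measurable_cons. Qed.

Section step.
Context (m1 : {sigma_finite_measure set T -> \bar R}) (n : nat)
        (m2 : {sigma_finite_measure set (n.-tuple T) -> \bar R}).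

Definition tcons_measure : set (n.+1.-tuple T) -> \bar R :=
  pushforward (m1 \x m2) (@tcons n).

Let tcons_measure0 : tcons_measure set0 = 0.
Proof. by rewrite /tcons_measure /pushforward preimage_set0 measure0. Qed.

Let tcons_measure_ge0 A : 0 <= tcons_measure A.
Proof. exact: (measure_ge0 (m1 \x m2)). Qed.

Let tcons_measure_sigma_additive : semi_sigma_additive tcons_measure.
Proof.
move=> F mF tF mUF; rewrite /tcons_measure /pushforward preimage_bigcup.
have mp k : measurable (@tcons n @^-1` F k).
  by rewrite -[X in measurable X]setTI; exact: measurable_tcons.
apply: (measure_semi_sigma_additive (s := m1 \x m2)) => //.
- apply/trivIsetP => /= i j _ _ ij; rewrite -preimage_setI.
  by move/trivIsetP : tF => -> //; rewrite preimage_set0.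
- by rewrite -preimage_bigcup -[X in measurable X]setTI; exact: measurable_tcons.
Qed.

HB.instance Definition _ := isMeasure.Build _ _ _ tcons_measure
  tcons_measure0 tcons_measure_ge0 tcons_measure_sigma_additive.

Let tcons_measure_sigma_finite : sigma_finite setT tcons_measure.
Proof.
have /sigma_finiteP[F [TF ndF Foo]] := sigma_finiteT m1.
have /sigma_finiteP[G [TG ndG Goo]] := sigma_finiteT m2.
pose g (t : n.+1.-tuple T) : T * n.-tuple T := (thead t, [tuple of behead t]).
have mg : measurable_fun setT g.
  apply/measurable_fun_pairP; split => /=.
    exact: measurable_tnth.
  exact: measurable_behead.
have gK (p : T * n.-tuple T) : g (tcons p) = p.
  by case: p => a b; congr pair; apply/val_inj.
exists (fun k => g @^-1` (F k `*` G k)).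
  apply/esym; rewrite -subTset => t _.
  have [k _ Fk] : (\bigcup_k F k) (thead t) by rewrite -TF.
  have [l _ Gl] : (\bigcup_k G k) [tuple of behead t] by rewrite -TG.
  exists (maxn k l) => //; split => /=.
  - by move: (thead t) Fk; exact/subsetPset/ndF/leq_maxl.
  - by move: [tuple of behead t] Gl; exact/subsetPset/ndG/leq_maxr.
move=> k; have [mF Fk] := Foo k; have [mG Gk] := Goo k; split.
  by rewrite -[X in measurable X]setTI; apply: mg => //; exact: measurableX.
rewrite /tcons_measure /pushforward -comp_preimage.
rewrite (_ : g \o @tcons n = id); last exact/funext.
by rewrite preimage_id product_measure1E// lte_mul_pinfty// ge0_fin_numE.
Qed.

HB.instance Definition _ := Measure_isSigmaFinite.Build _ _ _ tcons_measure
  tcons_measure_sigma_finite.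

End step.

(* The n-fold product measure mu \x ... \x mu, on n-tuples. *)
Fixpoint power_measure (mu : {sigma_finite_measure set T -> \bar R}) n :
    {sigma_finite_measure set (n.-tuple T) -> \bar R} :=
  match n with
  | 0 => \d_([tuple] : 0.-tuple T)
  | n'.+1 => tcons_measure mu (power_measure mu n')
  end.

End power_measure.

Lemma power_measure_setT (R : realType) (disp : measure_display)
    (T : measurableType disp) (P : probability T R) n :
  power_measure P n [set: n.-tuple T] = 1%E.
Proof.
elim: n => [|n IHn] /=; first by rewrite diracT.
rewrite /tcons_measure /pushforward preimage_setT -setXTT product_measure1E//.
by rewrite IHn mule1; exact: probability_setT.
Qed.

Section klee_measure.
Context (R : realType) (d : nat).

Definition point := d.-tuple (measurableTypeR R).

Definition lebesgue : set point -> \bar R :=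
  power_measure (@lebesgue_measure R) d.

(* The pair of the lower and the upper corner. *)
Definition box := (point * point)%type.

Definition in_unit_cube (b : box) : Prop :=
  forall j : 'I_d,
    [/\ 0 <= tnth b.1 j, tnth b.1 j <= tnth b.2 j & tnth b.2 j <= 1].

Definition box_set (b : box) : set point :=
  [set x | forall j : 'I_d, tnth b.1 j <= tnth x j <= tnth b.2 j].

Definition klee_measure (s : seq box) : R :=
  fine (lebesgue (\bigcup_(b in [set` s]) box_set b)).

End klee_measure.

(* Words and programs.

   Words are indivisible: a program moves real coordinates around and compares
   them, but it neither computes new reals to be stored nor stores constants of
   its own other than 0 and 1.  A word able to hold an arbitrary real function
   of the data could encode a whole stream, and space would be meaningless. *)

Inductive param := Epsilon | Rho.

(* A memory word is a [word d R].  A [word d (atom d)] is a recipe for building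
   one, and a [word d unit] is what remains of one when the coordinates of the
   points are hidden. *)
Inductive word (d : nat) (A : Type) :=
  | Point of d.-tuple A
  | Param of param
  | Counter of nat.
Arguments Param {d A} _.
Arguments Counter {d A} _.

Definition word_map d A B (f : A -> B) (w : word d A) : word d B :=
  match w with
  | Point x => Point (map_tuple f x)
  | Param p => Param p
  | Counter c => Counter c
  end.

Definition shape d A (mem : seq (word d A)) : seq (word d unit) :=
  map (word_map (fun=> tt)) mem.

(* [Coord i j] is the j-th coordinate of the i-th word being read. *)
Inductive atom (d : nat) :=
  | Coord of nat & 'I_d
  | ParamVal of param
  | Zero
  | One.
Arguments ParamVal {d} _.
Arguments Zero {d}.
Arguments One {d}.

Inductive decision_tree (d : nat) (A : Type) :=
  | Leaf of A
  | Branch_le (x y : atom d) (yes no : decision_tree d A).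

Inductive term (R : Type) (d : nat) :=
  | Const of R
  | Val of atom d
  | Add of term R d & term R d
  | Opp of term R d
  | Mul of term R d & term R d
  | Inv of term R d.

(* A one-pass algorithm over boxes; it does not know the length of the stream.
   The memory kept from one item to the next is a sequence of words (the sketch).
   Each step (initialization, arrival of an item, output) reads

     [coins] fresh random points,
     the corners of the current item (when an item arrives),
     the sketch (except at initialization),

   and runs a finite decision tree.  The tree may depend on everything that is
   not a real coordinate: the number and the kinds of the words read, and the
   values of the counters.  Its leaves give the new sketch or, in the final step,
   the output. *)
Record streaming_algorithm (R : Type) (d : nat) := StreamingAlgorithm {
  coins : nat ;
  initialize : decision_tree d (seq (word d (atom d))) ;
  process : seq (word d unit) -> decision_tree d (seq (word d (atom d))) ;
  output : seq (word d unit) -> decision_tree d (term R d)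
}.

Section semantics.
Context (R : realType) (d : nat) (eps rho : R).

Definition param_val (p : param) : R :=
  match p with Epsilon => eps | Rho => rho end.

(* [Coord i j] is 0 when there is no i-th word or it is not a point. *)
Definition atom_val (mem : seq (word d R)) (a : atom d) : R :=
  match a with
  | Coord i j => if nth (Counter 0) mem i is Point x then tnth x j else 0
  | ParamVal p => param_val p
  | Zero => 0
  | One => 1
  end.

Fixpoint tree_leaf A (mem : seq (word d R)) (t : decision_tree d A) : A :=
  match t with
  | Leaf a => a
  | Branch_le x y yes no =>
      tree_leaf mem (if atom_val mem x <= atom_val mem y then yes else no)
  end.

Fixpoint term_val (mem : seq (word d R)) (e : term R d) : R :=
  match e with
  | Const c => c
  | Val a => atom_val mem a
  | Add e1 e2 => term_val mem e1 + term_val mem e2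
  | Opp e1 => - term_val mem e1
  | Mul e1 e2 => term_val mem e1 * term_val mem e2
  | Inv e1 => (term_val mem e1)^-1
  end.

Definition run_tree (mem : seq (word d R))
    (t : decision_tree d (seq (word d (atom d)))) : seq (word d R) :=
  map (word_map (atom_val mem)) (tree_leaf mem t).

Section run.
Variables (alg : streaming_algorithm R d) (s : seq (box R d)).

(* The random tape: a block of points for the initialization, one for each item
   and one for the output. *)
Definition tape := (size s).+2.-tuple ((coins alg).-tuple (point R d)).

Definition uniform_tape : set tape -> \bar R :=
  power_measure
    (power_measure (power_measure (uniform_prob (@ltr01 R)) d) (coins alg))
    (size s).+2.

Definition coin_words (w : tape) (k : nat) : seq (word d R) :=
  map (@Point d R) (tnth w (inord k)).

(* The sketch after the first k items of s. *)
Fixpoint sketch (w : tape) (k : nat) : seq (word d R) :=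
  match k with
  | 0 => run_tree (coin_words w 0) (initialize alg)
  | k'.+1 =>
      let b := nth ([tuple 0 | _ < d], [tuple 0 | _ < d]) s k' in
      let mem := coin_words w k
                 ++ [:: Point b.1; Point b.2] ++ sketch w k' in
      run_tree mem (process alg (shape mem))
  end.

Definition answer (w : tape) : R :=
  let mem := coin_words w (size s).+1 ++ sketch w (size s) in
  term_val mem (tree_leaf mem (output alg (shape mem))).

(* A counter has \lceil log_2 n \rceil bits, where n is the length of the stream. *)
Definition fits (w : word d R) : bool :=
  if w is Counter c then (c < 2 ^ up_log 2 (size s))%N else true.

Definition uses_space (B : R) : Prop :=
  forall (w : tape) (k : nat), (k <= size s)%N ->
    all fits (sketch w k) /\ (size (sketch w k))%:R <= B.

Definition additive_solution : Prop :=
  ((1 - rho)%:E <=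
    uniform_tape [set w | `|klee_measure s - answer w| <= eps]%R)%E.

End run.

End semantics.

(* Main.v *)
Require Import Defs.
From mathcomp Require Import all_boot all_order all_algebra.
From mathcomp Require Import all_classical all_reals all_analysis.
From mathcomp Require Import measurable_realfun ring lra.

(* Keep m = O(ln(1/rho) / eps^2) uniform sample points and delete the ones
   covered by each arriving box: the fraction of deleted points estimates the
   volume, and by a Chernoff bound it is off by more than eps with probability
   at most 2 exp(- m eps^2 / 8).

   The factor 2 is too expensive when rho is close to 1, where the space allowed
   drops below any constant (down to no word at all).  If rho > 3/4, however, the
   fraction needs only be within v = eps / (4 (1 - rho)) of the volume with
   probability 1/2: adding an independent uniform noise in [-v, v] then gives an
   error at most eps with conditional probability at least
   eps / (2 v) = 2 (1 - rho). *)

Set Implicit Arguments.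
Unset Strict Implicit.
Unset Printing Implicit Defensive.

Import Order.TTheory GRing.Theory Num.Theory.

Local Open Scope classical_set_scope.
Local Open Scope ring_scope.

(** * Tonelli, marginals and independence for power measures on tuples *)

Section power_measure_theory.
Local Open Scope ereal_scope.
Context {R : realType} {disp : measure_display} {T : measurableType disp}.
Implicit Type mu : {sigma_finite_measure set T -> \bar R}.

Lemma tnth_tcons0 n (p : T * n.-tuple T) : tnth (tcons p) ord0 = p.1.
Proof. by []. Qed.

Lemma tnth_tconsS n (p : T * n.-tuple T) (i : 'I_n) :
  tnth (tcons p) (lift ord0 i) = tnth p.2 i.
Proof. by rewrite (tnth_nth p.1) /= [RHS](tnth_nth p.1). Qed.

Lemma preimage_tcons_measurable n (A : set (n.+1.-tuple T)) :
  measurable A -> measurable (@tcons _ T n @^-1` A).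
Proof. by move=> mA; rewrite -[X in measurable X]setTI; exact: measurable_tcons. Qed.

Lemma ge0_integral_power_measureS mu n (f : n.+1.-tuple T -> \bar R) :
  measurable_fun [set: n.+1.-tuple T] f -> (forall t, 0 <= f t) ->
  \int[power_measure mu n.+1]_t f t =
  \int[mu]_x \int[power_measure mu n]_t f (tcons (x, t)).
Proof.
move=> mf f0; rewrite /= /tcons_measure.
rewrite (ge0_integral_pushforward (@measurable_tcons _ T n)) // preimage_setT.
rewrite fubini_tonelli1//; last by move=> x; exact: f0.
exact: (measurableT_comp mf (@measurable_tcons _ T n)).
Qed.

(** Independence of the coordinates: Tonelli splits off the first one, and induction treats the
    rest. It will factor the exponential moment of a sum over the samples. *)
Lemma ge0_integral_prod_tnth mu n (f : 'I_n -> T -> R) :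
  (forall i, measurable_fun setT (f i)) -> (forall i x, (0 <= f i x)%R) ->
  \int[power_measure mu n]_t (\prod_(i < n) f i (tnth t i))%:E =
  \prod_(i < n) \int[mu]_x (f i x)%:E.
Proof.
elim: n f => [|n IHn] f mf f0.
  under eq_integral do rewrite big_ord0.
  by rewrite big_ord0 integral_cst//= diracT mule1.
have mprod m (g : 'I_m -> T -> R) : (forall i, measurable_fun setT (g i)) ->
    measurable_fun [set: m.-tuple T]
      (fun t => (\prod_(i < m) g i (tnth t i))%:E).
  move=> mg; apply/measurable_EFinP; apply: measurable_prod => i _.
  by apply: measurableT_comp => //; exact: measurable_tnth.
have prod0 m (g : 'I_m -> T -> R) : (forall i x, (0 <= g i x)%R) ->
    forall t : m.-tuple T, 0 <= (\prod_(i < m) g i (tnth t i))%:E.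
  by move=> g0 t; rewrite lee_fin prodr_ge0.
rewrite ge0_integral_power_measureS//; [|exact: mprod|exact: prod0].
rewrite big_ord_recl -(IHn (fun i => f (lift ord0 i)))//.
rewrite -ge0_integralZr//.
- apply: eq_integral => x _.
  rewrite -ge0_integralZl//.
  + apply: eq_integral => t _; rewrite big_ord_recl EFinM tnth_tcons0.
    by congr (_ * (_)%:E); apply: eq_bigr => i _; rewrite tnth_tconsS.
  + exact: (mprod n (fun i => f (lift ord0 i))).
  + by move=> t _; exact: (prod0 n (fun i => f (lift ord0 i))).
  + by rewrite lee_fin.
- exact/measurable_EFinP.
- by move=> x _; rewrite lee_fin.
- by apply: integral_ge0 => t _; exact: (prod0 n (fun i => f (lift ord0 i))).
Qed.

Lemma power_measure_mass1 mu n : mu setT = 1 ->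
  power_measure mu n [set: n.-tuple T] = 1.
Proof.
move=> mu1; elim: n => [|n IHn] /=; first by rewrite diracT.
rewrite /tcons_measure /pushforward preimage_setT -setXTT product_measure1E//.
by rewrite IHn mule1; exact: mu1.
Qed.

Lemma power_measure_tnth mu n (i : 'I_n) (B : set T) : mu setT = 1 ->
  measurable B -> power_measure mu n [set t | B (tnth t i)] = mu B.
Proof.
move=> mu1 mB; elim: n i => [[]//|n IHn] i.
rewrite /= /tcons_measure /pushforward.
case: (unliftP ord0 i) => [j|] ->.
- rewrite (_ : _ @^-1` _ = setT `*` [set t | B (tnth t j)]); last first.
    by apply/seteqP; split=> -[x t] /=; rewrite tnth_tconsS //; case.
  rewrite product_measure1E// ?[X in X * _](_ : _ = 1) ?mul1e//.
  by rewrite -[X in measurable X]setTI; exact: measurable_tnth.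
- rewrite (_ : _ @^-1` _ = B `*` setT); last first.
    by apply/seteqP; split=> -[x t] /=; rewrite tnth_tcons0 //; case.
  by rewrite product_measure1E// power_measure_mass1// mule1.
Qed.

(** On a tape of [n.+2] blocks the sample is read from the first block and the noise from the last.
    They are distinct blocks, hence independent, and the blocks in between have total mass 1 and
    integrate out. *)
Lemma power_measure_first_last mu n (S : set (T * T)) : mu setT = 1 ->
  measurable S ->
  power_measure mu n.+2 [set t | S (tnth t ord0, tnth t ord_max)] =
  (mu \x mu) S.
Proof.
move=> mu1 mS; rewrite /= /tcons_measure /pushforward.
apply: eq_integral => x _ /=.
rewrite -[RHS](@power_measure_tnth _ n.+1 ord_max)//; last exact: measurable_xsection.
congr (power_measure mu n.+1 _); apply/seteqP; split=> t /=;
  rewrite /xsection /= !inE /= tnth_tcons0.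
  by rewrite (_ : ord_max = lift ord0 ord_max) ?tnth_tconsS//; exact/val_inj.
by rewrite (_ : ord_max = lift ord0 ord_max) ?tnth_tconsS//; exact/val_inj.
Qed.

(** Conditioning on the first component: the measure of the section at [x] dominates [c] times the
    indicator of [G]; integrate over [x]. *)
Lemma product_measure_ge mu (S : set (T * T)) (G : set T) (c : R) :
  measurable S -> measurable G -> (0 <= c)%R ->
  (forall x, G x -> c%:E <= mu (xsection S x)) ->
  c%:E * mu G <= (mu \x mu) S.
Proof.
move=> mS mG c0 cS.
rewrite -[G]setIT -integral_indic// -ge0_integralZl//.
- apply: ge0_le_integral => //=.
  + by move=> x _; rewrite mule_ge0// lee_fin.
  + apply: measurable_funeM; exact/measurable_EFinP/measurable_indic.
  + exact: measurable_fun_xsection.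
  + move=> x _; rewrite indicE; case: (boolP (x \in G)) => xG.
      by rewrite mule1 cS//; move: xG; rewrite inE.
    by rewrite mule0.
- exact/measurable_EFinP/measurable_indic.
Qed.

End power_measure_theory.

(** * Boxes, and Lebesgue measure as uniform probability on the unit cube *)

Lemma measurable_box_set (R : realType) d (b : box R d) : measurable (box_set b).
Proof.
rewrite (_ : box_set b = \bigcap_(j in [set: 'I_d])
    ((fun x : Defs.point R d => tnth x j) @^-1` `[tnth b.1 j, tnth b.2 j])).
  apply: fin_bigcap_measurable => // j _.
  by rewrite -[X in measurable X]setTI; apply: measurable_tnth.
apply/seteqP; split=> x /=.
  by move=> bx j _ /=; rewrite in_itv/= bx.
by move=> bx j; move: (bx j I); rewrite /= in_itv.
Qed.

(** Induction on the dimension: integrating against the uniform law is Lebesgue integration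
    restricted to [0, 1], and the sections of [A] over first coordinates outside [0, 1] are
    empty. *)
Lemma lebesgue_uniform (R : realType) d (A : set (Defs.point R d)) :
  measurable A -> (forall x j, A x -> 0 <= tnth x j <= 1) ->
  lebesgue A = power_measure (uniform_prob (@ltr01 R)) d A.
Proof.
rewrite /lebesgue; elim: d A => [//|d IHd] A mA A01.
rewrite /= /tcons_measure /pushforward.
have mtA := preimage_tcons_measurable mA.
rewrite /product_measure1 integral_uniform//; last exact: measurable_fun_xsection.
rewrite subr0 invr1 mul1e [RHS]integral_mkcond; apply: eq_integral => x _ /=.
have A01x j t : xsection (@tcons _ _ d @^-1` A) x t ->
    0 <= tnth (tcons (x, t)) j <= 1.
  by rewrite /xsection /= inE /=; exact: A01.
rewrite patchE; case: ifPn => [_|xN].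
  apply: IHd => [|t j /A01x]; first exact: measurable_xsection.
  by move/(_ (lift ord0 j)); rewrite tnth_tconsS.
rewrite (_ : xsection _ _ = set0) ?measure0//.
rewrite -subset0 => t /(A01x ord0); rewrite tnth_tcons0 /= => x01.
by move: xN; rewrite notin_setE/= in_itv.
Qed.

(** * Chernoff bounds for the number of samples in a region *)

Section sampling.
Context {R : realType} {disp : measure_display} {T : measurableType disp}.
Variable P : {sigma_finite_measure set T -> \bar R}.
Hypothesis P1 : P setT = 1%E.

(* The entry of index 0 is not a sample: its slot is left to the final noise. *)
Definition hits m (D : set T) (t : m.+1.-tuple T) : R :=
  \sum_(i < m) \1_D (tnth t (lift ord0 i)).

Lemma measurable_hits m (D : set T) : measurable D ->
  measurable_fun [set: m.+1.-tuple T] (@hits m D).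
Proof.
move=> mD; apply: measurable_sum => i.
apply: measurableT_comp; [exact: measurable_indic|exact: measurable_tnth].
Qed.

Lemma hits_setC m (D : set T) (t : m.+1.-tuple T) :
  hits (~` D) t = m%:R - hits D t.
Proof.
apply/eqP; rewrite -subr_eq0 opprB addrA subr_eq0 -big_split /=; apply/eqP.
rewrite -[RHS]mulr1 mulr_natl -[in RHS](card_ord m) -sumr_const.
apply: eq_bigr => i _; rewrite !indicE in_setC.
by case: (_ \in D); rewrite ?addr0 ?add0r.
Qed.

(** Exponential moment of a shifted Bernoulli variable: exp (l 1_D) = 1 + (exp l - 1) 1_D is affine
    in the indicator. As l >= 0, both terms are nonnegative and can be integrated separately. *)
Lemma integral_expR_indic (D : set T) (q l b : R) :
  measurable D -> P D = q%:E -> 0 <= l ->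
  (\int[P]_x (expR (l * (\1_D x - b)))%:E =
   (expR (- (l * b)) * (1 + (expR l - 1) * q))%:E)%E.
Proof.
move=> mD PD l0.
have l1 : 0 <= expR l - 1 by rewrite subr_ge0 -expR0 ler_expR.
transitivity (\int[P]_x ((expR (- (l * b)))%:E +
    (expR (- (l * b)) * (expR l - 1))%:E * (\1_D x)%:E)%E)%E.
  apply: eq_integral => x _; rewrite -EFinM -EFinD; congr EFin.
  rewrite mulrBr expRD indicE; case: (x \in D); rewrite ?mulr0 ?mulr1 ?expR0; ring.
rewrite ge0_integralD//.
- rewrite integral_cst// ge0_integralZl//.
  + rewrite integral_indic// setIT [X in (_ * X + _)%E](_ : _ = 1%E)//.
    rewrite [X in (_ + _ * X)%E](_ : _ = q%:E)// mule1 -EFinM -EFinD.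
    by congr EFin; ring.
  + exact/measurable_EFinP/measurable_indic.
  + by rewrite lee_fin mulr_ge0.
- by move=> x _; rewrite -EFinM lee_fin !mulr_ge0.
- by apply: measurable_funeM; exact/measurable_EFinP/measurable_indic.
Qed.

(** From exp (- l) >= 1 - l follows (1 - l) exp l <= 1, while (1 - l) (1 + l + 2 l^2) = 1 + l^2 (1 -
    2 l) >= 1 because l <= 1/2. *)
Lemma expR_le_quadratic (l : R) : 0 <= l <= 2^-1 ->
  expR l <= 1 + l + 2 * l ^+ 2.
Proof.
move=> /andP[l0 l1].
have := expR_ge1Dx (- l); rewrite expRN => h.
have e0 := expR_gt0 l.
have : (1 - l) * expR l <= 1.
  by rewrite -[leRHS](mulVf (lt0r_neq0 e0)) ler_wpM2r// ltW.
move=> h2.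
suff : 1 <= (1 - l) * (1 + l + 2 * l ^+ 2).
  move=> h3; rewrite -(@ler_pM2l _ (1 - l)); last lra.
  exact: le_trans h2 h3.
have -> : (1 - l) * (1 + l + 2 * l ^+ 2) = 1 + l ^+ 2 * (1 - 2 * l) by ring.
rewrite lerDl mulr_ge0// ?sqr_ge0//; lra.
Qed.

(** The contribution of one sample to the exponential moment with parameter l = w / 4, the minimizer
    of 2 l^2 - l w. The bound 1 + x <= exp x turns the product into a single exponential. *)
Lemma chernoff_factor (q w : R) : 0 <= q <= 1 -> 0 <= w <= 1 ->
  expR (- (w / 4 * (q + w))) * (1 + (expR (w / 4) - 1) * q) <=
  expR (- (w ^+ 2 / 8)).
Proof.
move=> /andP[q0 q1] /andP[w0 w1].
have hl : 0 <= w / 4 <= 2^-1 by lra.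
have h := expR_le_quadratic hl.
apply: (@le_trans _ _ (expR (- (w / 4 * (q + w))) *
    expR (q * (w / 4 + 2 * (w / 4) ^+ 2)))).
  rewrite ler_wpM2l ?expR_ge0//; apply: le_trans (expR_ge1Dx _).
  rewrite lerD2l mulrC ler_wpM2l//; lra.
rewrite -expRD ler_expR.
have -> : - (w / 4 * (q + w)) + q * (w / 4 + 2 * (w / 4) ^+ 2) =
  - (w ^+ 2 / 8) - w ^+ 2 / 8 * (1 - q) by field.
by rewrite gerDl oppr_le0 mulr_ge0// ?divr_ge0 ?sqr_ge0// subr_ge0.
Qed.

(** Markov's inequality for exp ((w / 4) (hits - m (q + w))), which is at least 1 on the event and
    factors over the independent samples. *)
Lemma hits_upper_tail m (D : set T) (q w : R) :
  measurable D -> P D = q%:E -> 0 <= q <= 1 -> 0 <= w <= 1 ->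
  (power_measure P m.+1 [set t | (m%:R * (q + w) <= hits D t)%R] <=
   (expR (- (m%:R * w ^+ 2 / 8)))%:E)%E.
Proof.
move=> mD PD q01 w01; have /andP[w0 _] := w01.
set E := [set t | _].
(* Index 0 is not a sample, so it gets the neutral factor 1. *)
pose f (i : 'I_m.+1) x : R :=
  if i == ord0 then 1 else expR (w / 4 * (\1_D x - (q + w))).
have mE : measurable E.
  rewrite (_ : E = @hits m D @^-1` `[m%:R * (q + w), +oo[).
    rewrite -[X in measurable X]setTI; exact: measurable_hits.
  by apply/seteqP; split=> t; rewrite /E /= in_itv /= andbT.
have f_0 x : f ord0 x = 1 by [].
have f_S i x : f (lift ord0 i) x = expR (w / 4 * (\1_D x - (q + w))) by [].
have prodE (t : m.+1.-tuple T) : \prod_(i < m.+1) f i (tnth t i) =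
    expR (w / 4 * (hits D t - m%:R * (q + w))).
  rewrite big_ord_recl f_0 mul1r /hits.
  under eq_bigr => i _ do rewrite f_S.
  rewrite -expR_sum -mulr_sumr big_split /= sumr_const card_ord.
  by rewrite mulNrn mulr_natl.
have mf i : measurable_fun setT (f i).
  rewrite /f; case: (i == ord0); first exact: measurable_cst.
  apply: measurableT_comp => //; apply: measurable_funM => //.
  exact: measurable_funB.
have f0 i x : 0 <= f i x by rewrite /f; case: ifP => // _; exact: expR_ge0.
rewrite -[E]setIT -integral_indic//.
apply: (@le_trans _ _
    (\int[power_measure P m.+1]_t (\prod_(i < m.+1) f i (tnth t i))%:E)%E).
  apply: ge0_le_integral => //=.
  - exact/measurable_EFinP/measurable_indic.
  - apply/measurable_EFinP; apply: measurable_prod => i _.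
    by apply: measurableT_comp => //; exact: measurable_tnth.
  - move=> t _; rewrite lee_fin prodE indicE.
    case: (boolP (t \in E)) => [|_]; last exact: expR_ge0.
    rewrite inE /E /= => Et; rewrite -[leLHS]expR0 ler_expR.
    by rewrite mulr_ge0 ?divr_ge0// subr_ge0.
rewrite ge0_integral_prod_tnth// big_ord_recl.
under eq_integral => x _ do rewrite f_0.
rewrite integral_cst// mul1e.
rewrite [X in (X * _)%E](_ : _ = 1%E)// mul1e.
under eq_bigr => i _.
  under eq_integral => x _ do rewrite f_S.
  rewrite (integral_expR_indic _ mD PD) ?divr_ge0//.
  over.
rewrite prodEFin lee_fin prodr_const card_ord.
rewrite -[in leRHS]mulrA -[in leRHS]mulrN expRM_natl.
rewrite lerXn2r// ?nnegrE ?expR_ge0//; last exact: chernoff_factor.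
rewrite mulr_ge0 ?expR_ge0// addr_ge0// mulr_ge0 ?(andP q01).1// subr_ge0.
by rewrite -expR0 ler_expR divr_ge0.
Qed.

Lemma mass1_setC (D : set T) (q : R) : measurable D -> P D = q%:E ->
  P (~` D) = (1 - q)%:E.
Proof.
move=> mD PD.
have : (P (D `|` ~` D) = q%:E + P (~` D))%E.
  by rewrite (measureU P mD (measurableC mD) (setICr D)); congr (_ + _)%E.
rewrite setUCr => h; have {h} : (1%:E = q%:E + P (~` D))%E by rewrite -h; exact/esym.
by case: (P (~` D)) => [r| |]// [h]; congr EFin; lra.
Qed.

(** Too few hits of [D] means too many hits of its complement, so the upper tail bound is applied to
    both sets and the failures are added by a union bound. *)
Lemma hits_concentration m (D : set T) (q w : R) :
  measurable D -> P D = q%:E -> 0 <= q <= 1 -> 0 <= w <= 1 ->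
  ((1 - 2 * expR (- (m%:R * w ^+ 2 / 8)))%:E <=
   power_measure P m.+1 [set t | (`|hits D t - m%:R * q| <= m%:R * w)%R])%E.
Proof.
move=> mD PD q01 w01.
set e := expR _; set G := [set t | _].
pose E1 := [set t : m.+1.-tuple T | m%:R * (q + w) <= hits D t].
pose E2 := [set t : m.+1.-tuple T | m%:R * ((1 - q) + w) <= hits (~` D) t].
have mge (B : set T) (c : R) : measurable B ->
    measurable [set t : m.+1.-tuple T | c <= hits B t].
  move=> mB; rewrite (_ : [set t | _] = @hits m B @^-1` `[c, +oo[).
    by rewrite -[X in measurable X]setTI; exact: measurable_hits.
  by apply/seteqP; split=> t; rewrite /= in_itv /= andbT.
have mE1 : measurable E1 by exact: mge.
have mE2 : measurable E2 by apply: mge; exact: measurableC.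
have mG : measurable G.
  rewrite (_ : G = @hits m D @^-1` `[m%:R * q - m%:R * w, m%:R * q + m%:R * w]).
    by rewrite -[X in measurable X]setTI; exact: measurable_hits.
  by apply/seteqP; split=> t; rewrite /G /= in_itv /= ler_distl.
have cover : [set: m.+1.-tuple T] `<=` G `|` (E1 `|` E2).
  move=> t _; rewrite /setU /= /G /E1 /E2 /= hits_setC.
  have [Gt|] := leP `|hits D t - m%:R * q| (m%:R * w); first by left.
  by rewrite ltr_normr => /orP[h|h]; right; [left|right]; lra.
have P2 := hits_upper_tail m mD PD q01 w01.
have q01' : 0 <= 1 - q <= 1 by lra.
have P3 := hits_upper_tail m (measurableC mD) (mass1_setC mD PD) q01' w01.
rewrite EFinB leeBlDr//.
have <- : power_measure P m.+1 setT = 1%E by exact: power_measure_mass1.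
apply: (@le_trans _ _ (power_measure P m.+1 (G `|` (E1 `|` E2)))).
  apply: le_measure => //; rewrite ?inE//.
  by apply: measurableU => //; exact: measurableU.
apply: (le_trans (measureU2 _ mG (measurableU _ _ mE1 mE2))).
rewrite leeD2l//; apply: (le_trans (measureU2 _ mE1 mE2)).
by rewrite mulr2n mulrDl mul1r EFinD leeD.
Qed.

End sampling.

(** * The sample mean *)

Lemma hits_ge0_le (R : realType) disp (T : measurableType disp) m (D : set T)
    (t : m.+1.-tuple T) : 0 <= hits (R := R) D t <= m%:R.
Proof.
rewrite /hits sumr_ge0//=; apply: le_trans (_ : \sum_(i < m) 1 <= _).
  by apply: ler_sum => i _; rewrite indicE lern1 leq_b1.
by rewrite sumr_const card_ord.
Qed.

Section mean.
Context {R : realType} {disp : measure_display} {T : measurableType disp}.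
Variable P : {sigma_finite_measure set T -> \bar R}.
Hypothesis P1 : P setT = 1%E.
Variables (m : nat) (D : set T) (q w : R).
Hypotheses (mD : measurable D) (PD : P D = q%:E) (q01 : 0 <= q <= 1).

Lemma mean_concentration : (0 < m)%N -> 0 <= w <= 1 ->
  ((1 - 2 * expR (- (m%:R * w ^+ 2 / 8)))%:E <=
   power_measure P m.+1 [set t | (`|hits D t / m%:R - q| <= w)%R])%E.
Proof.
move=> m0 w01; apply: le_trans (hits_concentration P1 m mD PD q01 w01) _.
have m0' : 0 < m%:R :> R by rewrite ltr0n.
have normE (h : R) : (`|h - m%:R * q| <= m%:R * w) = (`|h / m%:R - q| <= w).
  rewrite (_ : h / m%:R - q = (h - m%:R * q) / m%:R); last first.
    by field; rewrite lt0r_neq0.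
  by rewrite normrM normfV (gtr0_norm m0') ler_pdivrMr// [_ * w]mulrC.
rewrite (_ : [set t | _] = [set t : m.+1.-tuple T | `|hits D t / m%:R - q| <= w])//.
by apply/seteqP; split=> t /=; rewrite normE.
Qed.

(** The quotient and [q] both lie in [0, 1], whatever the sample. This includes [m = 0], where
    division by 0 yields 0. *)
Lemma mean_far (t : m.+1.-tuple T) : 1 <= w -> `|hits D t / m%:R - q| <= w.
Proof.
move=> w1; have /andP[h0 hm] := hits_ge0_le R D t.
apply: le_trans w1; have : 0 <= (hits D t : R) / m%:R <= 1.
  rewrite divr_ge0//=; have [m0|m0] := posnP m.
    by rewrite [X in X%:R^-1]m0 invr0 mulr0.
  by rewrite ler_pdivrMr ?ltr0n// mul1r.
by move: q01 => /andP[? ?] /andP[? ?]; rewrite ler_norml; apply/andP; split; lra.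
Qed.

End mean.

(** * Uniform noise on an interval *)

Lemma uniform_prob_itv (R : realType) (a b : R) : 0 <= a -> a <= b -> b <= 1 ->
  uniform_prob (@ltr01 R) `[a, b]%classic = (b - a)%:E.
Proof.
move=> a0 ab b1.
rewrite -[X in uniform_prob _ X]setIT -integral_indic//.
rewrite integral_uniform//; last exact/measurable_EFinP/measurable_indic.
rewrite subr0 invr1 mul1e integral_indic//.
rewrite setIidl; last first.
  move=> x /=; rewrite !in_itv/= => /andP[ax xb].
  by rewrite (le_trans a0)//= (le_trans xb).
apply: etrans (lebesgue_measure_itv `[a, b]) _; rewrite /= lte_fin.
by case: ltgtP ab => // -> _; rewrite subrr.
Qed.

(* The admissible [u] form an interval centred in [0, 1] of radius
   [eps / (2 * v) <= 1 / 2], one half of which is thus included in [0, 1]. *)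
Lemma noise_hits (R : realType) (eps v t : R) :
  0 < eps <= v -> `|t| <= v ->
  ((eps / (2 * v))%:E <=
   uniform_prob (@ltr01 R) [set u | (`|t + v - 2 * v * u| <= eps)%R])%E.
Proof.
move=> /andP[e0 ev]; rewrite ler_norml => /andP[tv vt].
have v0 : 0 < v by exact: lt_le_trans ev.
set r := eps / (2 * v); set c := (t + v) / (2 * v).
have r0 : 0 < r by rewrite divr_gt0// mulr_gt0.
have r1 : r <= 2^-1 by rewrite ler_pdivrMr ?mulr_gt0//; lra.
have c0 : 0 <= c by rewrite divr_ge0// ?mulr_ge0//; lra.
have c1 : c <= 1 by rewrite ler_pdivrMr ?mulr_gt0//; lra.
have targetE (u : R) : (`|t + v - 2 * v * u| <= eps) = (`|u - c| <= r).
  have -> : t + v - 2 * v * u = 2 * v * (c - u).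
    by rewrite /c; field; rewrite lt0r_neq0.
  rewrite normrM ger0_norm; last by rewrite mulr_ge0// ltW.
  by rewrite distrC mulrC -ler_pdivlMr// mulr_gt0.
have -> : [set u | (`|t + v - 2 * v * u| <= eps)%R] = `[c - r, c + r]%classic.
  by apply/seteqP; split=> u; rewrite /= targetE in_itv /= ler_distl.
set target := (X in uniform_prob _ X).
have sub_itv (a b : R) : a <= b -> 0 <= a -> b <= 1 -> c - r <= a -> b <= c + r ->
    b - a = r -> (r%:E <= uniform_prob (@ltr01 R) target)%E.
  move=> ab a0 b1 ac bc <-; rewrite -uniform_prob_itv//.
  apply: le_measure; rewrite ?inE /target//.
  move=> u; rewrite /target /= !in_itv /= => /andP[au ub].
  by rewrite (le_trans ac au) (le_trans ub bc).
have [chalf|chalf] := leP c 2^-1.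
- by apply: (sub_itv c (c + r)); lra.
- by apply: (sub_itv (c - r) c); lra.
Qed.

(** * The noisy estimate and its success probability *)

Section estimate.
Context {R : realType} (d : nat) (j0 : 'I_d).

Let U := power_measure (uniform_prob (@ltr01 R)) d.

Let U1 : U setT = 1%E.
Proof. exact: power_measure_setT. Qed.

Definition noise m (y : m.+1.-tuple (Defs.point R d)) : R :=
  tnth (tnth y ord0) j0.

(* [D] is the region the boxes leave uncovered.  Without samples (m = 0) the
   division by 0 makes the estimate uniform on [1 - v, 1 + v]. *)
Definition estimate m (D : set (Defs.point R d)) (v : R)
    (x y : m.+1.-tuple (Defs.point R d)) : R :=
  1 - hits D x / m%:R - v + 2 * v * noise y.

Lemma measurable_noise m : measurable_fun setT (@noise m).
Proof.
apply: (measurableT_comp (f := fun x : Defs.point R d => tnth x j0)).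
  exact: measurable_tnth.
exact: measurable_tnth.
Qed.

Lemma noise_uniform m (B : set (measurableTypeR R)) : measurable B ->
  power_measure U m.+1 [set y | B (noise y)] = uniform_prob (@ltr01 R) B.
Proof.
move=> mB.
have mB' : measurable [set x : Defs.point R d | B (tnth x j0)].
  by rewrite -[X in measurable X]setTI; exact: measurable_tnth.
rewrite (power_measure_tnth ord0 U1 mB') /U power_measure_tnth//.
exact: probability_setT.
Qed.

(** A good sample has probability at least [g]; given any good sample, the noise succeeds with
    probability at least [c]. Sample and noise are independent, so the two bounds multiply. *)
Lemma estimate_success n m (D : set (Defs.point R d)) (q eps r v c g : R) :
  measurable D -> 0 <= c ->
  (g%:E <= power_measure U m.+1 [set x | (`|hits D x / m%:R - q| <= r)%R])%E ->
  (forall t : R, `|t| <= r ->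
    (c%:E <= uniform_prob (@ltr01 R) [set u | (`|t + v - 2 * v * u| <= eps)%R])%E) ->
  ((c * g)%:E <= power_measure (power_measure U m.+1) n.+2
    [set w | (`|1 - q - estimate D v (tnth w ord0) (tnth w ord_max)| <= eps)%R])%E.
Proof.
move=> mD c0 gG ct.
set G := [set x | _] in gG.
pose S := [set p : m.+1.-tuple (Defs.point R d) * m.+1.-tuple (Defs.point R d) |
  `|1 - q - estimate D v p.1 p.2| <= eps].
have mhits : measurable_fun setT (fun x : m.+1.-tuple (Defs.point R d) =>
    hits D x / m%:R - q : R).
  apply: measurable_funB => //; apply: measurable_funM => //.
  exact: measurable_hits.
have mG : measurable G.
  rewrite (_ : G = (fun x : m.+1.-tuple (Defs.point R d) =>
    hits D x / m%:R - q : R) @^-1` `[- r, r]).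
    by rewrite -[X in measurable X]setTI; exact: mhits.
  by apply/seteqP; split=> x; rewrite /G /= in_itv /= ler_norml.
have mu1 : power_measure U m.+1 setT = 1%E by exact: power_measure_mass1.
(* With t the error of the sample mean and u the noise, the total error is t + v - 2 v u, the form
   bounded in the hypothesis on [c]. *)
have errE (x y : m.+1.-tuple (Defs.point R d)) : 1 - q - estimate D v x y =
    (hits D x / m%:R - q) + v - 2 * v * noise y by rewrite /estimate; ring.
have mS : measurable S.
  pose err (p : m.+1.-tuple (Defs.point R d) * m.+1.-tuple (Defs.point R d)) :=
    (hits D p.1 / m%:R - q) + v - 2 * v * noise p.2.
  have merr : measurable_fun setT err.
    apply: measurable_funB.
      apply: measurable_funD => //.
      exact: (measurableT_comp mhits).
    apply: measurable_funM => //.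
    exact: (measurableT_comp (@measurable_noise m)).
  rewrite (_ : S = err @^-1` `[- eps, eps]).
    by rewrite -[X in measurable X]setTI; exact: merr.
  by apply/seteqP; split=> p; rewrite /S /= in_itv /= -ler_norml errE.
have := power_measure_first_last n mu1 mS; rewrite {1}/S /= => ->.
apply: le_trans (product_measure_ge mS mG c0 _).
  by rewrite EFinM lee_wpmul2l// lee_fin.
move=> x Gx; apply: (le_trans (ct _ Gx)).
set B := [set u | _]; rewrite -(noise_uniform m).
  rewrite le_eqVlt; apply/orP; left; apply/eqP; congr (power_measure _ _ _).
  by apply/seteqP; split=> y; rewrite /xsection /= inE /S /= errE.
rewrite (_ : B = (fun u => (hits D x / m%:R - q) + v - 2 * v * u) @^-1` `[- eps, eps]).
  rewrite -[X in measurable X]setTI.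
  have : measurable_fun [set: measurableTypeR R]
     (fun u => (hits D x / m%:R - q) + v - 2 * v * u).
    by apply: measurable_funB => //; exact: measurable_funM.
  exact.
by apply/seteqP; split=> u; rewrite /B /= in_itv /= ler_norml.
Qed.

End estimate.

(** * Choice of the sample size and of the noise width *)

Definition space_bound (R : realType) (eps rho : R) : R :=
  192 * (1 / eps ^+ 2 * ln (1 / rho)).

Definition sample_size (R : realType) (eps rho : R) : nat :=
  Num.truncn (space_bound eps rho).

Definition noise_width (R : realType) (eps rho : R) : R :=
  if rho <= 3 / 4 then 0 else eps / (4 * (1 - rho)).

Section parameters.
Context {R : realType} (eps rho : R).
Hypotheses (eps01 : 0 < eps < 1) (rho01 : 0 < rho < 1).

Let e0 : 0 < eps. Proof. by case/andP: eps01. Qed.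
Let e1 : eps < 1. Proof. by case/andP: eps01. Qed.
Let r0 : 0 < rho. Proof. by case/andP: rho01. Qed.
Let r1 : rho < 1. Proof. by case/andP: rho01. Qed.

(** This is exp x >= 1 + x at x = ln rho. It compares the allowed space with 1 - rho when [rho] is
    near 1. *)
Lemma ln_inv_ge : 1 - rho <= ln (1 / rho).
Proof.
rewrite div1r lnV ?posrE//; have := expR_ge1Dx (ln rho).
rewrite lnK ?posrE//; lra.
Qed.

Lemma space_bound_ge0 : 0 <= space_bound eps rho.
Proof.
rewrite /space_bound mulr_ge0// mulr_ge0// ?div1r ?invr_ge0 ?sqr_ge0//.
by have := ln_inv_ge; rewrite div1r; move: r1; lra.
Qed.

Lemma sample_size_le : (sample_size eps rho)%:R <= space_bound eps rho.
Proof. by rewrite /sample_size truncn_le space_bound_ge0. Qed.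

Lemma sample_size_gt0 : (0 < sample_size eps rho)%N = (1 <= space_bound eps rho).
Proof. by rewrite /sample_size truncn_gt0. Qed.

(** A real number below m + 1 is at most 2 m once m >= 1, so rounding down costs at most a factor 2
    and 192 becomes 96. *)
Lemma sample_size_ge : (0 < sample_size eps rho)%N ->
  96 * ln (1 / rho) <= (sample_size eps rho)%:R * eps ^+ 2.
Proof.
move=> m0; have := truncnS_gt (space_bound eps rho).
rewrite -/(sample_size eps rho) -natr1 {1}/space_bound => h.
have m1 : 1 <= (sample_size eps rho)%:R :> R by rewrite ler1n.
have e2 : 0 < eps ^+ 2 by rewrite exprn_gt0.
have : 192 * (1 / eps ^+ 2 * ln (1 / rho)) <= 2 * (sample_size eps rho)%:R by lra.
rewrite -(ler_pM2r e2).
have -> : 192 * (1 / eps ^+ 2 * ln (1 / rho)) * eps ^+ 2 = 192 * ln (1 / rho).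
  by field; rewrite !lt0r_neq0.
lra.
Qed.

(** The exponential is at most rho^12, hence at most rho^4, and 2 rho^3 <= 2 (3/4)^3 < 1. The sample
    is nonempty because 192 (1 - rho) >= 48. *)
Lemma small_rho_tail : rho <= 3 / 4 -> (0 < sample_size eps rho)%N /\
  2 * expR (- ((sample_size eps rho)%:R * eps ^+ 2 / 8)) <= rho.
Proof.
move=> r34; have Lge := ln_inv_ge.
have m0 : (0 < sample_size eps rho)%N.
  rewrite sample_size_gt0 /space_bound.
  have : 1 <= 1 / eps ^+ 2 by rewrite ler_pdivlMr ?exprn_gt0// mul1r expr_le1// ltW.
  nra.
split=> //; have := sample_size_ge m0.
set k := (sample_size _ _)%:R * _ => hk.
have : expR (- (k / 8)) <= rho ^+ 4.
  rewrite -[X in _ <= X ^+ 4](@lnK _ rho) ?posrE// -expRM_natl ler_expR.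
  move: hk Lge; rewrite div1r lnV ?posrE//; lra.
have : 2 * rho ^+ 3 <= 1.
  have : rho ^+ 3 <= (3 / 4) ^+ 3 by rewrite lerXn2r ?nnegrE ?divr_ge0// ltW.
  lra.
have -> : rho ^+ 4 = rho * rho ^+ 3 by rewrite exprS.
move=> c1 ec; apply: (@le_trans _ _ (2 * (rho * rho ^+ 3))); first lra.
by rewrite mulrCA ler_piMr// ltW.
Qed.

Lemma large_rho_width : 3 / 4 < rho ->
  eps <= noise_width eps rho /\
  (1 <= noise_width eps rho \/
   (0 < sample_size eps rho)%N /\
   2 * expR (- ((sample_size eps rho)%:R * noise_width eps rho ^+ 2 / 8)) <= 2^-1).
Proof.
move=> r34; have Lge := ln_inv_ge.
rewrite /noise_width [rho <= _]leNgt r34 /=; set v := eps / _.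
have d0 : 0 < 4 * (1 - rho) by move: r1; lra.
have ve : eps <= v by rewrite ler_pdivlMr//; rewrite ler_piMr ?ltW//; lra.
split=> //.
(* Without samples the space bound is below 1, so 192 (1 - rho) <= 192 ln (1 / rho) < eps^2 <= eps,
   which forces v >= 1. *)
have [m0|m0] := ltnP 0 (sample_size eps rho); [right|left]; last first.
  move: m0; rewrite leqNgt sample_size_gt0 -ltNge /space_bound => h.
  have e2 : 0 < eps ^+ 2 by rewrite exprn_gt0.
  have : 192 * ln (1 / rho) < eps ^+ 2.
    move: h; rewrite -(ltr_pM2r e2) [ltRHS]mul1r.
    have -> : 192 * (1 / eps ^+ 2 * ln (1 / rho)) * eps ^+ 2 = 192 * ln (1 / rho).
      by field; rewrite !lt0r_neq0.
    by [].
  move=> h2; rewrite ler_pdivlMr// mul1r.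
  have : eps ^+ 2 <= eps by rewrite expr2 ler_piMr// ltW.
  lra.
split=> //; have := sample_size_ge m0; set m := (sample_size _ _)%:R => hm.
(* Since m eps^2 >= 96 (1 - rho), the right-hand side is at least 3 / (4 (1 - rho)), and 1 - rho <
   1/4. The value 3 suffices because exp 3 >= 1 + 3, so 2 exp (- 3) <= 1/2. *)
have h3 : 3 <= m * v ^+ 2 / 8.
  have -> : m * v ^+ 2 / 8 = m * eps ^+ 2 / (128 * (1 - rho) ^+ 2).
    by rewrite /v; field; rewrite lt0r_neq0//; lra.
  rewrite ler_pdivlMr; last by rewrite mulr_gt0// exprn_gt0//; lra.
  apply: le_trans hm; nra.
have h4 : 4 <= expR (m * v ^+ 2 / 8) by apply: le_trans (expR_ge1Dx _); lra.
rewrite expRN ler_pdivrMr ?expR_gt0//; lra.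
Qed.

End parameters.

Lemma estimate_correct (R : realType) (eps rho : R) d (j0 : 'I_d) n
    (D : set (Defs.point R d)) (q : R) (m := sample_size eps rho) :
  0 < eps < 1 -> 0 < rho < 1 -> measurable D -> 0 <= q <= 1 ->
  power_measure (uniform_prob (@ltr01 R)) d D = q%:E ->
  ((1 - rho)%:E <=
   power_measure (power_measure (power_measure (uniform_prob (@ltr01 R)) d) m.+1) n.+2
    [set w | (`|1 - q - estimate j0 D (noise_width eps rho)
                   (tnth w ord0) (tnth w ord_max)| <= eps)%R])%E.
Proof.
move=> eps01 rho01 mD q01 PD; have /andP[e0 e1] := eps01.
have /andP[r0 r1] := rho01.
have U1 : power_measure (uniform_prob (@ltr01 R)) d setT = 1%E.
  exact: power_measure_setT.
have [r34|r34] := leP rho (3 / 4).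
  have [m0 tail] := small_rho_tail eps01 rho01 r34.
  (* The noise has width 0, so it succeeds surely (c = 1) once the sample mean is within [eps]. *)
  rewrite -[1 - rho]mul1r; apply: (@estimate_success _ _ _ _ _ _ q _ eps) => //.
    apply: le_trans (mean_concentration U1 mD PD q01 m0 _); last by rewrite !ltW.
    by rewrite lee_fin lerB.
  move=> t te; rewrite /noise_width r34.
  rewrite (_ : [set u | _] = setT) ?probability_setT//.
  by apply/seteqP; split=> // u _; rewrite /= mulr0 mul0r subr0 addr0.
have [ev tail] := large_rho_width eps01 rho01 r34.
set v := noise_width eps rho in ev tail *.
have v0 : 0 < v by exact: lt_le_trans ev.
have c2 : eps / (2 * v) = 2 * (1 - rho).
  rewrite /v /noise_width leNgt r34 /=; field.
  by rewrite !lt0r_neq0//; lra.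
(* The noise contributes 2 (1 - rho) and the sample 1/2. *)
have -> : 1 - rho = eps / (2 * v) * 2^-1 by rewrite c2; lra.
apply: (@estimate_success _ _ _ _ _ _ q _ v) => //.
- by rewrite divr_ge0 ?mulr_ge0 ?ltW.
(* For v >= 1 every sample is good, even an empty one; otherwise the tail bound applies. *)
- have [v1|v1] := leP 1 v.
    rewrite (_ : [set x | _] = setT).
      rewrite power_measure_mass1// lee_fin; lra.
    by apply/seteqP; split=> // x _; exact: mean_far.
  case: tail => [|[m0 tail]]; first by rewrite leNgt v1.
  apply: le_trans (mean_concentration U1 mD PD q01 m0 _); last by rewrite !ltW.
  by rewrite lee_fin; lra.
- by move=> t tv; apply: noise_hits => //; rewrite e0.
Qed.

(** * The algorithm as decision trees *)

Section algorithm.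
Context {R : realType} {d : nat}.

Definition in_box (b : box R d) (x : Defs.point R d) : bool :=
  [forall j, tnth b.1 j <= tnth x j <= tnth b.2 j].

Definition copy_point (i : nat) : word d (atom d) :=
  Point [tuple Coord i j | j < d].

Fixpoint inside_tree A (js : seq 'I_d) (lo i hi : nat)
    (yes no : decision_tree d A) : decision_tree d A :=
  if js is j :: js' then
    Branch_le (Coord lo j) (Coord i j)
      (Branch_le (Coord i j) (Coord hi j) (inside_tree js' lo i hi yes no) no) no
  else yes.

(* Deleting the covered points, rather than counting them, avoids counters: on a
   stream of one item a counter can only hold 0. *)
Fixpoint survivors_tree (lo hi : nat) (ks kept : seq nat) :
    decision_tree d (seq (word d (atom d))) :=
  if ks is i :: ks' then
    inside_tree (enum 'I_d) lo i hi (survivors_tree lo hi ks' kept)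
      (survivors_tree lo hi ks' (rcons kept i))
  else Leaf _ (map copy_point kept).

(** When an item arrives, words 0 to m are the coins, m + 1 and m + 2 the corners of the box, and
    the sketch starts at m + 3; at the output it starts at m + 1. Coin 0 is left out of the sample,
    and in the final step its coordinate [j0] supplies the noise. *)
Definition klee_algorithm (j0 : 'I_d) (m : nat) (v : R) : streaming_algorithm R d :=
  {| coins := m.+1 ;
     initialize := Leaf _ (map copy_point (iota 1 m)) ;
     process sh := survivors_tree m.+1 m.+2 (iota m.+3 (size sh - m.+3)) [::] ;
     output sh := Leaf _
       (Add (Const d (1 - (size sh - m.+1)%:R / m%:R - v))
            (Mul (Const d (2 * v)) (Val R (Coord 0 j0)))) |}.

(** * Evaluation of the trees on a memory of points *)

Variables (eps rho : R).
Local Notation atom_val := (atom_val eps rho).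
Local Notation run_tree := (run_tree eps rho).

Let x0 : Defs.point R d := [tuple 0 | _ < d].

Lemma atom_val_Coord (ps : seq (Defs.point R d)) i j : (i < size ps)%N ->
  atom_val (map (@Point d R) ps) (Coord i j) = tnth (nth x0 ps i) j.
Proof. by move=> ips; rewrite /= (nth_map x0). Qed.

Lemma word_map_copy_point (ps : seq (Defs.point R d)) i : (i < size ps)%N ->
  word_map (atom_val (map (@Point d R) ps)) (copy_point i) = Point (nth x0 ps i).
Proof.
move=> ips; congr Point; apply: eq_from_tnth => j.
by rewrite tnth_map tnth_mktuple atom_val_Coord.
Qed.

Lemma map_word_map_copy_point (ps : seq (Defs.point R d)) (ks : seq nat) :
  {in ks, forall i, i < size ps}%N ->
  map (word_map (atom_val (map (@Point d R) ps))) (map copy_point ks) =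
  map (@Point d R) (map (nth x0 ps) ks).
Proof.
move=> ksps; rewrite -!map_comp; apply/eq_in_map => i /ksps.
exact: word_map_copy_point.
Qed.

Lemma tree_leaf_inside A (ps : seq (Defs.point R d)) js lo i hi
    (yes no : decision_tree d A) :
  (lo < size ps)%N -> (i < size ps)%N -> (hi < size ps)%N ->
  tree_leaf eps rho (map (@Point d R) ps) (inside_tree js lo i hi yes no) =
  tree_leaf eps rho (map (@Point d R) ps)
    (if all (fun j => tnth (nth x0 ps lo) j <= tnth (nth x0 ps i) j
                        <= tnth (nth x0 ps hi) j) js then yes else no).
Proof.
move=> los ips his; elim: js => //= j js IHjs.
rewrite !(nth_map x0)//=; case: (_ <= _) => //=.
by rewrite !(nth_map x0)//=; case: (_ <= _).
Qed.

(** Induction on [ks] for an arbitrary accumulator [kept], since each uncovered point extends it. *)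
Lemma run_survivors_tree (ps : seq (Defs.point R d)) lo hi ks kept :
  (lo < size ps)%N -> (hi < size ps)%N ->
  {in ks, forall i, i < size ps}%N -> {in kept, forall i, i < size ps}%N ->
  run_tree (map (@Point d R) ps) (survivors_tree lo hi ks kept) =
  map (@Point d R) (map (nth x0 ps) kept ++
    [seq x <- map (nth x0 ps) ks | ~~ in_box (nth x0 ps lo, nth x0 ps hi) x]).
Proof.
move=> los his; elim: ks kept => [|i ks IHks] kept ksps keptps.
  by rewrite /run_tree /= cats0 map_word_map_copy_point.
have ips : (i < size ps)%N by apply: ksps; rewrite mem_head.
rewrite /run_tree /= tree_leaf_inside//.
have -> : all (fun j => tnth (nth x0 ps lo) j <= tnth (nth x0 ps i) j
      <= tnth (nth x0 ps hi) j) (enum 'I_d) =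
    in_box (nth x0 ps lo, nth x0 ps hi) (nth x0 ps i).
  apply/allP/forallP => h j; last by move=> _; exact: h.
  by apply: h; rewrite mem_enum.
have ksps' : {in ks, forall i, i < size ps}%N.
  by move=> k kks; apply: ksps; rewrite inE kks orbT.
case: in_box => /=; first exact: IHks.
rewrite -/(run_tree _ _) IHks// ?map_rcons ?cat_rcons//.
by move=> k; rewrite mem_rcons inE => /orP[/eqP->|/keptps].
Qed.

(** * The sketch along the stream, its size, and the answer *)

Section run.
Variables (j0 : 'I_d) (m : nat) (v : R) (s : seq (box R d)).
Local Notation alg := (klee_algorithm j0 m v).
Variable w : tape alg s.

(** Deletions accumulate: filtering the survivors by the next box is filtering the initial sample by
    one more box. Coins drawn while items arrive are ignored, so only block 0 of the tape
    matters. *)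
Lemma sketchE k : (k <= size s)%N ->
  sketch eps rho w k = map (@Point d R)
    [seq x <- behead (tnth w ord0) | ~~ has (in_box^~ x) (take k s)].
Proof.
elim: k => [|k IHk] kn.
  rewrite /= take0 filter_predT /run_tree /coin_words /=.
  rewrite (_ : inord 0 = ord0); last by apply/val_inj; rewrite /= inordK.
  rewrite map_word_map_copy_point.
    congr map; rewrite map_nth_iota ?size_tuple ?subn1// drop1 take_oversize//.
    by rewrite size_behead size_tuple.
  by move=> i; rewrite mem_iota add1n => /andP[_]; rewrite size_tuple.
set b := nth (x0, x0) s k.
rewrite /= IHk ?(ltnW kn)// /coin_words; set kept := seq.filter _ _.
set c := tnth w _.
pose ps := c ++ [:: b.1; b.2] ++ kept.
have -> : map (@Point d R) c ++
    [:: Point b.1, Point b.2 & map (@Point d R) kept] = map (@Point d R) ps.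
  by rewrite /ps !map_cat.
have sizeps : size ps = (m.+3 + size kept)%N.
  by rewrite /ps !size_cat size_tuple /= !addnS !addSn.
rewrite /Defs.shape !size_map sizeps addKn run_survivors_tree ?sizeps//.
- rewrite map_nth_iota; last by rewrite sizeps addKn.
  rewrite cat0s.
  have -> : drop m.+3 ps = kept.
    by rewrite /ps catA drop_size_cat// size_cat size_tuple /= addn2.
  have -> : nth x0 ps m.+1 = b.1.
    by rewrite /ps nth_cat size_tuple ltnn subnn.
  have -> : nth x0 ps m.+2 = b.2.
    by rewrite /ps nth_cat size_tuple ltnNge leqnSn /= subSnn.
  rewrite take_oversize// /kept -filter_predI; congr map; apply: eq_filter => x /=.
  by rewrite (take_nth (x0, x0) kn) has_rcons negb_or -surjective_pairing.
- by rewrite !ltn_addr.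
- by rewrite !ltn_addr.
- by move=> i; rewrite mem_iota => /andP[].
Qed.

(** The sketch holds points only, so the bound on counters is vacuous, and it is filtered from [m]
    initial points. *)
Lemma sketch_fits_size k : (k <= size s)%N ->
  all (fits s) (sketch eps rho w k) /\ (size (sketch eps rho w k) <= m)%N.
Proof.
move=> kn; rewrite sketchE// all_map; split; first by apply/allP.
rewrite size_map size_filter; apply: leq_trans (count_size _ _) _.
by rewrite size_behead size_tuple.
Qed.

Lemma hits_count (D : set (Defs.point R d)) (p : pred (Defs.point R d))
    (x : m.+1.-tuple (Defs.point R d)) : (forall y, p y = (y \in D)) ->
  hits D x = (count p (behead x))%:R :> R.
Proof.
move=> pD; case/tupleP: x => y t.
transitivity (\sum_(z <- t) \1_D z : R).
  by rewrite big_tuple /hits; apply: eq_bigr => i _; rewrite tnthS.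
rewrite -sum1_count natr_sum [RHS]big_mkcond /=.
by apply: eq_bigr => z _; rewrite indicE pD; case: (_ \in D).
Qed.

(** The final sketch consists of the samples in the uncovered region, so its length is the number of
    hits of [D]; word 0 is then a coin of the last block. *)
Lemma answerE (D : set (Defs.point R d)) :
  D = ~` (\bigcup_(b in [set` s]) box_set b) ->
  answer eps rho w = estimate j0 D v (tnth w ord0) (tnth w ord_max).
Proof.
move=> DE; rewrite /answer sketchE// take_size /coin_words.
set kept := seq.filter _ _; rewrite -map_cat /estimate.
rewrite /= (nth_map x0) ?size_cat ?size_tuple//.
rewrite /Defs.shape !size_map size_cat size_tuple addKn.
have -> : (size kept)%:R = hits D (tnth w ord0) :> R.
  rewrite size_filter; apply/esym/hits_count => y; rewrite DE.
  rewrite in_setC; congr negb; apply/hasP/idP.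
    move=> [b bs /forallP by_]; rewrite inE; exists b => // j; exact: by_.
  by rewrite inE => -[b bs by_]; exists b => //; apply/forallP => j; exact: by_.
have -> : inord (size s).+1 = ord_max :> 'I_(size s).+2.
  by apply/val_inj; rewrite /= inordK.
rewrite nth_cat size_tuple /=; congr (_ + _ * _).
by rewrite /noise (tnth_nth x0).
Qed.

End run.

End algorithm.

(** * Klee's measure as a probability, and the guarantees of the algorithm *)

Lemma klee_measure_prob (R : realType) d (s : seq (box R d))
    (A := \bigcup_(b in [set` s]) box_set b) :
  (forall b, b \in s -> in_unit_cube b) ->
  [/\ measurable A, 0 <= klee_measure s <= 1 &
   power_measure (uniform_prob (@ltr01 R)) d A = (klee_measure s)%:E].
Proof.
move=> s01.
have mA : measurable A.
  apply: fin_bigcup_measurable => [|b _]; first exact: finite_seq.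
  exact: measurable_box_set.
have lebE : lebesgue A = power_measure (uniform_prob (@ltr01 R)) d A.
  apply: lebesgue_uniform => // x j [b bs bx].
  have [b0 _ b1] := s01 b bs j; have /andP[lx xh] := bx j.
  by rewrite (le_trans b0)//= (le_trans xh).
have p1 : (power_measure (uniform_prob (@ltr01 R)) d A <= 1)%E.
  by rewrite -(power_measure_setT (uniform_prob (@ltr01 R)) d) le_measure ?inE.
have p0 : (0 <= power_measure (uniform_prob (@ltr01 R)) d A)%E by [].
have pfin : power_measure (uniform_prob (@ltr01 R)) d A \is a fin_num.
  by rewrite ge0_fin_numE// (le_lt_trans p1)// ltry.
rewrite /klee_measure -/A lebE; split => //; last by rewrite fineK.
by rewrite -!lee_fin fineK// p0.
Qed.

Theorem theorem5 (R : realType) :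
  exists2 C : R, 0 < C &
  forall d : nat, (0 < d)%N ->
  exists alg : R -> R -> streaming_algorithm R d,
  forall eps rho : R, 0 < eps < 1 -> 0 < rho < 1 ->
  forall s : seq (box R d), (forall b, b \in s -> in_unit_cube b) ->
    additive_solution eps rho (alg eps rho) s /\
    uses_space eps rho (alg eps rho) s (C * (1 / eps ^+ 2 * ln (1 / rho))).
Proof.
exists 192 => // d d0; pose j0 := Ordinal d0.
exists (fun eps rho =>
  klee_algorithm j0 (sample_size eps rho) (noise_width eps rho)).
move=> eps rho eps01 rho01 s s01; split; last first.
  move=> w k ks; have [fit small] := sketch_fits_size eps rho w ks.
  split=> //; rewrite -/(space_bound eps rho).
  apply: le_trans (sample_size_le eps rho01).
  by rewrite ler_nat.
have [mA /andP[p0 p1] PA] := klee_measure_prob s01.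
have U1 : power_measure (uniform_prob (@ltr01 R)) d setT = 1%E.
  exact: power_measure_setT.
have q01 : 0 <= 1 - klee_measure s <= 1 by apply/andP; split; lra.
(* Applied to the uncovered region, whose measure q is 1 - V, so that 1 - q is the volume V. *)
have := estimate_correct j0 (size s) eps01 rho01 (measurableC mA) q01
  (mass1_setC U1 mA PA).
rewrite opprB addrCA subrr addr0 /additive_solution /uniform_tape => h.
apply: (le_trans h); rewrite le_eqVlt; apply/orP; left; apply/eqP.
congr (power_measure _ _ _); apply/seteqP; split=> w /=.
  by rewrite (answerE _ _ _ erefl).
by rewrite (answerE _ _ _ erefl).
Qed.
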